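(* There is an absolute numerical constant $C>0$ such that for every stochastic $K$-armed bandit ($K\ge2$) with reward distributions supported on $[0,1]$ and means $\mu_1\ge\cdots\ge\mu_K$, and every horizon $T$, the KL-MS algorithm satisfies \[ \mathrm{Reg}(T)\le C\sum_{a:\Delta_a>0}\frac{\ln T}{\Delta_a}. \] (That is, KL-MS is sub-UCB.)
   Context: Bandit model: arm $i\in[K]$ has reward distribution $\nu_i$ on $[0,1]$ with mean $\mu_i$, indexed so $\mu_1\ge\cdots\ge\mu_K$. At round $t$ the learner picks $I_t$ and observes $y_t\sim\nu_{I_t}$ independently of the past given $I_t$. $N_{t,a}$ = number of pulls of arm $a$ in rounds $1..t$; $\hat\mu_{t,a}$ = empirical mean of arm $a$'s rewards up to round $t$; $\hat\mu_{t,\max}=\max_a\hat\mu_{t,a}$; $\Delta_a=\mu_1-\mu_a$; $\mathrm{Reg}(T)=T\mu_1-\mathbb E\sum_{t=1}^Ty_t$. $\mathsf{kl}(p,q)=p\ln\frac pq+(1-p)\ln\frac{1-p}{1-q}$. KL-MS: for $t\le K$ pull arm $t$; for $t\ge K+1$ pull $I_t\sim p_t$ with $p_{t,a}\propto\exp(-N_{t-1,a}\,\mathsf{kl}(\hat\mu_{t-1,a},\hat\mu_{t-1,\max}))$. *)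

(* Defs.v *)
From HB Require Import structures.
From mathcomp Require Import all_boot all_order all_algebra.
From mathcomp Require Import all_classical all_reals all_analysis.
Set Implicit Arguments. Unset Strict Implicit. Unset Printing Implicit Defensive.
Import Order.TTheory GRing.Theory Num.Theory.
Local Open Scope ring_scope.

Section KLMS.
Variables (R : realType) (K : nat).

(* A history is the sequence of (arm, observed reward) pairs, oldest first. *)
Definition history := seq ('I_K * R).

Definition npulls (h : history) (a : 'I_K) : nat :=
  count (fun p => p.1 == a) h.

(* \hat\mu_{t,a}: empirical mean of arm a (unused before the arm is pulled). *)
Definition muhat (h : history) (a : 'I_K) : R :=
  (\sum_(p <- h | p.1 == a) p.2) / (npulls h a)%:R.

(* \hat\mu_{t,max}; rewards lie in [0,1] a.s., so empirical means are >= 0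
   and 0 is a neutral initial value for the max. *)
Definition muhatmax (h : history) : R := \big[Num.max/0]_(a < K) muhat h a.

(* Bernoulli KL divergence kl(p,q) = p ln(p/q) + (1-p) ln((1-p)/(1-q)),
   with 0 ln(...) = 0. *)
Definition kl (p q : R) : R :=
  p * ln (p / q) + (1 - p) * ln ((1 - p) / (1 - q)).

Definition kl_infinite (p q : R) : bool :=
  ((q == 0) && (p != 0)) || ((q == 1) && (p != 1)).

(* Unnormalised KL-MS weight exp(-N kl(p,q)), with exp(-oo) = 0. *)
Definition klms_weight (n : nat) (p q : R) : R :=
  if kl_infinite p q then 0 else expR (- (n%:R * kl p q)).

(* Probability with which KL-MS pulls arm a at the next round, given history h
   (round t = size h + 1): for t <= K pull arm t (0-based index size h),
   otherwise p_{t,a} proportional to exp(-N_{t-1,a} kl(muhat_a, muhat_max)). *)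
Definition klms_policy (h : history) (a : 'I_K) : R :=
  if (size h < K)%N then (if nat_of_ord a == size h then 1 else 0)
  else klms_weight (npulls h a) (muhat h a) (muhatmax h) /
       \sum_(b < K) klms_weight (npulls h b) (muhat h b) (muhatmax h).

Variable nu : 'I_K -> probability R R.

Fixpoint klms_future_reward (n : nat) (h : history) : \bar R :=
  match n with
  | 0 => 0%E
  | n'.+1 => (\sum_(a < K) (klms_policy h a)%:E *
              \int[nu a]_y (y%:E + klms_future_reward n' (rcons h (a, y))))%E
  end.

Definition arm_mean (a : 'I_K) : R := fine (\int[nu a]_x x%:E)%E.

End KLMS.

(* Reg(T) = T mu_1 - E sum_{t<=T} y_t, where arm 1 (index 0) is the best. *)
Definition klms_regret (R : realType) (K : nat) (nu : 'I_K.+1 -> probability R R)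
  (T : nat) : \bar R :=
  ((T%:R * arm_mean nu ord0)%:E - klms_future_reward nu T [::])%E.

(* Main.v *)
(** Regret is the sum of the gaps weighted by expected pull counts, so it suffices to bound the
    expected number of pulls of each suboptimal arm [a], of gap [D], by [O(ln T / D ^ 2)].
    This is done by a potential on histories that, in conditional expectation, decreases at
    each round by at least the probability of pulling [a]; being convex in the last reward, it
    only needs to be tested on Bernoulli rewards.  With [m] slightly below the best mean [mu1]
    and [N] counting the pulls of the arm under consideration, a pull of [a] is paid for
    - by a counter while [a] has been pulled fewer than [8 ln T / D ^ 2] times;
    - by an exponential supermartingale if the empirical mean of [a] is too large;
    - by [1 / T] if that mean is small and the largest empirical mean is at least [m], since
      then the weight of [a] is at most [exp (- N D ^ 2 / 8)];
    - otherwise the best arm looks bad.  Then [p_a <= p_1 e ^ Y] with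
      [Y = N kl (muhat_1, m)], while [P (Y >= k) <= e ^ (1 - k - N d)] with [d] of order
      [D ^ 2].  Peeling over the integer levels [k <= ln T], and using [p_a <= 1] on
      [Y >= ln T], bounds the expected number of such pulls by a multiple of
      [ln T * sum_N e ^ (- N d)], which is of order [ln T / D ^ 2]. *)

Require Import Defs.
From HB Require Import structures.
From mathcomp Require Import all_boot all_order all_algebra.
From mathcomp Require Import all_classical all_reals all_analysis.
From mathcomp Require Import measurable_realfun.
From mathcomp Require Import ring lra zify.
Set Implicit Arguments.
Unset Strict Implicit.
Import Order.TTheory GRing.Theory Num.Theory numFieldNormedType.Exports.
Local Open Scope ring_scope.

(** * Integrals against laws on the unit interval *)

(** The integral is a difference of suprema over simple functions below the positive and negative
    parts, and these are monotone whatever the regularity of [f] and [g]. *)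
Lemma le_integral_nonmeasurable {d} {T : measurableType d} {R : realType}
    (mu : {measure set T -> \bar R}) (f g : T -> \bar R) :
  (forall x, f x <= g x)%E -> (\int[mu]_x f x <= \int[mu]_x g x)%E.
Proof.
move=> fg; rewrite /integral !patch_setT; apply: leeB.
- apply: ereal_sup_le => _ [h hf <-]; exists h => // x.
  by apply: (le_trans (hf x)); apply: (@funepos_le _ _ setT) => //; rewrite inE.
- apply: ereal_sup_le => _ [h hf <-]; exists h => // x.
  by apply: (le_trans (hf x)); apply: (@funeneg_le _ _ setT) => //; rewrite inE.
Qed.

Section unit_interval.
Context {R : realType} (nu : probability R R).
Hypothesis nu01 : nu `[0%R, 1%R]%classic = 1%E.

Lemma unit_interval_null : nu (~` `[0%R : R, 1%R])%classic = 0%E.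
Proof. by rewrite probability_setC// nu01 subee. Qed.

Lemma integrable_unit_interval : nu.-integrable setT (fun x : R => x%:E).
Proof.
apply/integrableP; split; first exact/measurable_EFinP.
rewrite (@ge0_negligible_integral _ _ _ _ _ (~` `[0%R : R, 1%R])%classic)//=; last 3 first.
- exact: measurableC.
- by apply: measurableT_comp => //; exact/measurable_EFinP.
- exact: unit_interval_null.
rewrite setTD setCK; apply: (@le_lt_trans _ _ (\int[nu]_(x in `[0%R, 1%R]) (cst 1%E x))%E).
  apply: ge0_le_integral => //.
  - by apply: measurableT_comp => //; exact/measurable_EFinP.
  - by move=> x /=; rewrite in_itv/= lee_fin => /andP[x0 x1]; rewrite ger0_norm.
by rewrite integral_cst// mul1e [X in (X < _)%E](_ : _ = 1%E) ?ltry//; exact: nu01.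
Qed.

Lemma mean_unit_interval : 0 <= fine (\int[nu]_x x%:E)%E <= 1.
Proof.
have := integrable_unit_interval => /integrable_fin_num fin.
have ae : ae_eq nu setT (fun x : R => x%:E)
    (fun x => (x * \1_(`[0%R, 1%R]%classic) x)%:E).
  exists (~` `[0%R : R, 1%R])%classic; split => //.
  - exact: measurableC.
  - exact: unit_interval_null.
  - move=> x /= h1 h2; apply: h1 => _.
    by rewrite indicE mem_set// mulr1.
have m1 : measurable_fun setT (fun x : R => (x * \1_(`[0%R, 1%R]%classic) x)%:E).
  by apply/measurable_EFinP; apply: measurable_funM => //; exact: measurable_indic.
have mid : measurable_fun setT (fun x : R => x%:E) by exact/measurable_EFinP.
have ind01 (x : R) : 0 <= x * \1_(`[0%R, 1%R]%classic) x <= 1.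
  rewrite indicE; have [|] := boolP (x \in _); last by rewrite mulr0 lexx ler01.
  by rewrite inE/= in_itv/= mulr1.
rewrite -!lee_fin fineK; last exact: fin.
have -> : (\int[nu]_x x%:E = \int[nu]_x (x * \1_(`[0%R, 1%R]%classic) x)%:E)%E.
  exact: ae_eq_integral.
apply/andP; split.
  by apply: integral_ge0 => x _; rewrite lee_fin; case/andP: (ind01 x).
apply: (@le_trans _ _ (\int[nu]_(x in setT) (cst 1%E x))%E).
  apply: ge0_le_integral => //.
  - by move=> x _; rewrite lee_fin; case/andP: (ind01 x).
  - by move=> x _; rewrite lee_fin; case/andP: (ind01 x).
by rewrite integral_cst// mul1e probability_le1.
Qed.

(** A law thus enters only through its mean. Nothing is asked of [f] outside the unit interval,
    which carries all the mass. *)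
Lemma integral_ge_affine (f : R -> \bar R) (al be : R) :
  (forall y, 0 <= y <= 1 -> ((al + be * y)%:E <= f y)%E) ->
  ((al + be * fine (\int[nu]_x x%:E))%:E <= \int[nu]_y f y)%E.
Proof.
move=> hf.
(* The value [-oo] off the unit interval puts [F] below [f] everywhere, while [F] still equals the
   affine function almost everywhere. *)
pose F (y : R) : \bar R := if y \in `[0%R, 1%R] then (al + be * y)%:E else -oo%E.
have ae : ae_eq nu setT F (fun y => (al + be * y)%:E).
  exists (~` `[0%R : R, 1%R])%classic; split => //.
  - exact: measurableC.
  - exact: unit_interval_null.
  - by move=> y /= h1 h2; apply: h1 => _; rewrite /F h2.
have mg : measurable_fun setT (fun y : R => (al + be * y)%:E).
  apply/measurable_EFinP; apply: measurable_funD => //.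
have mF : measurable_fun setT F.
  apply: measurable_fun_ifT => //.
  apply: (measurable_fun_bool true) => /=.
  rewrite (_ : (_ @^-1` _)%classic = `[0%R, 1%R]%classic)//.
  exact: measurableI.
apply: (@le_trans _ _ (\int[nu]_y F y)%E); last first.
  apply: le_integral_nonmeasurable => y; rewrite /F; case: ifPn => [|_]; last exact: leNye.
  by rewrite in_itv/= => /hf.
rewrite (_ : \int[nu]_y F y = \int[nu]_y (al + be * y)%:E)%E; last exact: ae_eq_integral.
under [leRHS]eq_integral do rewrite EFinD.
have iid := integrable_unit_interval.
rewrite integralD//; first 1 last.
- exact: finite_measure_integrable_cst.
- by under eq_fun do rewrite EFinM; exact: integrableZl.
under [X in (_ + X)%E]eq_integral do rewrite EFinM.
rewrite integralZl// integral_cst//= [X in (_ * X + _)%E](_ : _ = 1%E);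
  last exact: probability_setT.
rewrite mule1.
by rewrite EFinD EFinM fineK//; exact: (integrable_fin_num _ iid).
Qed.
End unit_interval.

(** * Bernoulli divergence and exponential tilts *)

Section real_lemmas.
Local Open Scope classical_set_scope.
Local Open Scope ring_scope.
Context {R : realType}.
Implicit Types p q x m u y c d : R.

Lemma ln_le_sub1 x : 0 < x -> ln x <= x - 1.
Proof.
move=> x0; have := @le_ln1Dx R (x - 1).
by rewrite (addrC 1) subrK; apply; rewrite ltrBrDr addrC subrr.
Qed.

(** The tangent at [c * y] bounds [expR] from below at 0 and at [c]; in the weighted average the
    linear terms cancel. *)
Lemma expR_chord c y : 0 <= y <= 1 -> expR (c * y) <= 1 - y + y * expR c.
Proof.
move=> /andP[y0 y1]; set z := c * y.
have e0 : expR z * (1 - z) <= 1.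
  have := expR_ge1Dx (- z); rewrite expRN => h.
  by rewrite -(@ler_pM2l _ (expR z)^-1) ?invr_gt0 ?expR_gt0// mulKf ?mulr1// gt_eqF ?expR_gt0.
have e1 : expR z * (1 + (c - z)) <= expR c.
  have -> : expR c = expR z * expR (c - z) by rewrite -expRD addrC subrK.
  by apply: ler_wpM2l; [exact: expR_ge0|exact: expR_ge1Dx].
have : (1 - y) * (expR z * (1 - z)) + y * (expR z * (1 + (c - z))) <= 1 - y + y * expR c.
  have h1 : 0 <= 1 - y by rewrite subr_ge0.
  by have := ler_wpM2l h1 e0; have := ler_wpM2l y0 e1; lra.
suff -> : (1 - y) * (expR z * (1 - z)) + y * (expR z * (1 + (c - z))) = expR z by [].
by rewrite /z; ring.
Qed.

Lemma expRN_le_half d : 0 <= d <= 1 -> expR (- d) <= 1 - d / 2.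
Proof.
move=> /andP[d0 d1]; have := expR_ge1Dx d => h.
rewrite expRN; apply: (@le_trans _ _ (1 + d)^-1).
  by rewrite lef_pV2 ?posrE ?expR_gt0//; lra.
rewrite -(@ler_pM2l _ (1 + d)); last lra.
rewrite divff; [nra|lra].
Qed.

Lemma sum_expRN_le d T : 0 < d <= 1 -> \sum_(0 <= n < T) expR (- (n%:R * d)) <= 2 / d.
Proof.
move=> /andP[d0 d1].
(* The extra factor makes the bound strong enough for the induction. *)
have h : \sum_(0 <= n < T) expR (- (n%:R * d)) <= (1 - expR (- (T%:R * d))) * (2 / d).
  elim: T => [|T IH]; first by rewrite big_nil mul0r oppr0 expR0 subrr mul0r.
  rewrite big_nat_recr//=; apply: (le_trans (lerD IH (lexx _))).
  have e : expR (- (T.+1%:R * d)) = expR (- (T%:R * d)) * expR (- d).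
    by rewrite -expRD; congr expR; rewrite -natr1; ring.
  rewrite e; have h := @expRN_le_half d.
  have h2 : expR (- d) <= 1 - d / 2 by apply: h; rewrite ltW.
  set X := expR (- (T%:R * d)); have X0 : 0 <= X by exact: expR_ge0.
  have : X * (1 - (1 - d/2)) <= X * (1 - expR (-d)) by apply: ler_wpM2l => //; lra.
  have D0 : 0 <= 2 / d by rewrite divr_ge0// ltW.
  move=> /(ler_wpM2r D0); rewrite (_ : X * (1 - (1 - d / 2)) * (2 / d) = X); last by field; lra.
  lra.
apply: (le_trans h); apply: ler_piMl; first by rewrite divr_ge0// ltW.
by have := expR_ge0 (- (T%:R * d)); lra.
Qed.

Lemma kl_self p : kl p p = 0.
Proof.
rewrite /kl; have aux x : x * ln (x / x) = 0 :> R.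
  by have [->|x0] := eqVneq x 0; rewrite ?mul0r// divff// ln1 mulr0.
by rewrite !aux addr0.
Qed.

(* [ln t <= t - 1] at [t = sqrt (q / p)]: each half of [kl] dominates a Hellinger term. *)
Lemma hellinger_half p q : 0 <= p -> 0 <= q -> (q == 0 -> p == 0) ->
  2 * p - 2 * (Num.sqrt p * Num.sqrt q) <= p * ln (p / q).
Proof.
move=> p0 q0 hpq; have [->|pn0] := eqVneq p 0.
  by rewrite mul0r mulr0 sqrtr0 mul0r mulr0 subrr.
have qn0 : q != 0 by apply: contra pn0 => /hpq.
have pp : 0 < p by rewrite lt_def pn0.
have qq : 0 < q by rewrite lt_def qn0.
have sp : 0 < Num.sqrt p by rewrite sqrtr_gt0.
have sq : 0 < Num.sqrt q by rewrite sqrtr_gt0.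
have e1 : ln (p / q) = - (2 * ln (Num.sqrt q / Num.sqrt p)).
  have lnsq (x : R) : 0 < x -> ln x = 2 * ln (Num.sqrt x).
    move=> x0; rewrite -{1}(sqr_sqrtr (ltW x0)) lnXn ?sqrtr_gt0//.
    by rewrite mulr_natl.
  rewrite !ln_div ?posrE// (lnsq p)// (lnsq q)//; ring.
have := @ln_le_sub1 (Num.sqrt q / Num.sqrt p) (divr_gt0 sq sp).
rewrite e1; set L := ln _ => hL.
have e2 : p * (Num.sqrt q / Num.sqrt p) = Num.sqrt p * Num.sqrt q.
  rewrite -{1}(sqr_sqrtr p0); field; lra.
have : p * L <= p * (Num.sqrt q / Num.sqrt p - 1) by rewrite ler_pM2l.
rewrite mulrBr e2 => h; lra.
Qed.

(** Pinsker's inequality with a weaker constant: the two Hellinger bounds add up to two squared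
    differences of square roots, each at least [(p - q) ^+ 2 / 4]. Finiteness excludes the points
    where division by zero falsifies [kl]. *)
Lemma kl_ge_sqr p q : 0 <= p <= 1 -> 0 <= q <= 1 -> ~~ kl_infinite p q ->
  (p - q) ^+ 2 / 2 <= kl p q.
Proof.
move=> /andP[p0 p1] /andP[q0 q1]; rewrite /kl_infinite negb_or !negb_and !negbK => /andP[h0 h1].
have a1 : 2 * p - 2 * (Num.sqrt p * Num.sqrt q) <= p * ln (p / q).
  by apply: hellinger_half => // qe; case/orP: h0 => //; rewrite qe.
have a2 : 2 * (1 - p) - 2 * (Num.sqrt (1 - p) * Num.sqrt (1 - q))
    <= (1 - p) * ln ((1 - p) / (1 - q)).
  apply: hellinger_half; rewrite ?subr_ge0// => qe; case/orP: h1.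
    by move: qe; rewrite subr_eq0 eq_sym => ->.
  by rewrite subr_eq0 eq_sym.
rewrite /kl; apply: le_trans (lerD a1 a2).
have := sqr_sqrtr p0; have := sqr_sqrtr q0.
have p1' : 0 <= 1 - p by rewrite subr_ge0.
have q1' : 0 <= 1 - q by rewrite subr_ge0.
have := sqr_sqrtr p1'; have := sqr_sqrtr q1'.
have : 0 <= Num.sqrt p <= 1 by rewrite sqrtr_ge0 -[X in _ <= X]sqrtr1 ler_sqrt.
have : 0 <= Num.sqrt q <= 1 by rewrite sqrtr_ge0 -[X in _ <= X]sqrtr1 ler_sqrt.
have : 0 <= Num.sqrt (1 - p) <= 1.
  by rewrite sqrtr_ge0 -[X in _ <= X]sqrtr1 ler_sqrt// lerBlDr lerDl.
have : 0 <= Num.sqrt (1 - q) <= 1.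
  by rewrite sqrtr_ge0 -[X in _ <= X]sqrtr1 ler_sqrt// lerBlDr lerDl.
move: (Num.sqrt p) (Num.sqrt q) (Num.sqrt (1 - p)) (Num.sqrt (1 - q)) => a b c e.
move=> /andP[e0 e1] /andP[c0 c1] /andP[b0 b1] /andP[a0 a1'] eq1 eq2 eq3 eq4.
have k1 : (p - q) ^+ 2 <= 4 * (a - b) ^+ 2.
  have -> : p - q = (a + b) * (a - b) by rewrite -eq3 -eq4; ring.
  rewrite exprMn.
  by apply: ler_wpM2r; [exact: sqr_ge0|nra].
have k2 : (p - q) ^+ 2 <= 4 * (c - e) ^+ 2.
  have -> : p - q = (c + e) * (e - c).
    have -> : p - q = (1 - q) - (1 - p) by ring.
    by rewrite -eq1 -eq2; ring.
  rewrite exprMn -[(c - e) ^+ 2]sqrrN opprB.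
  by apply: ler_wpM2r; [exact: sqr_ge0|nra].
nra.
Qed.

Lemma kl_ge0 p q : 0 <= p <= 1 -> 0 <= q <= 1 -> ~~ kl_infinite p q -> 0 <= kl p q.
Proof.
move=> hp hq h; apply: le_trans (kl_ge_sqr hp hq h).
by rewrite divr_ge0// sqr_ge0.
Qed.

Lemma kl_finite p q : 0 < q < 1 -> kl_infinite p q = false.
Proof.
by move=> /andP[q0 q1]; rewrite /kl_infinite (gt_eqF q0) (lt_eqF q1).
Qed.

Lemma kl_split x q m : 0 <= x -> 0 < q -> q < 1 -> 0 < m < 1 -> x < 1 ->
  kl x m = kl x q + (x * ln (q / m) + (1 - x) * ln ((1 - q) / (1 - m))).
Proof.
move=> x0 q0 q1 /andP[m0 m1] x1; rewrite /kl.
have x1' : 0 < 1 - x by lra.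
have q1' : 0 < 1 - q by lra.
have m1' : 0 < 1 - m by lra.
rewrite (ln_div x1' q1') (ln_div x1' m1') (ln_div q0 m0) (ln_div q1' m1').
have [->|xn0] := eqVneq x 0; first by rewrite !mul0r; ring.
have xp : 0 < x by rewrite lt_def xn0.
by rewrite (ln_div xp q0) (ln_div xp m0); ring.
Qed.

Lemma kl_cross_antitone x y q m : 0 < q -> q <= m -> m < 1 -> x <= y ->
  y * ln (q / m) + (1 - y) * ln ((1 - q) / (1 - m)) <=
  x * ln (q / m) + (1 - x) * ln ((1 - q) / (1 - m)).
Proof.
move=> q0 qm m1 xy.
have l1 : ln (q / m) <= 0 by rewrite ln_le0// ler_pdivrMr ?mul1r//; lra.
have l2 : 0 <= ln ((1 - q) / (1 - m)) by rewrite ln_ge0// ler_pdivlMr ?mul1r; lra.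
nra.
Qed.

(** By [kl_split], [kl x m - kl x q] is affine in [x]; it is nonincreasing and equals [kl q m] at
    [x = q]. *)
Lemma kl_triangle x q m : 0 <= x -> x <= q -> q <= m -> 0 < q -> m < 1 ->
  kl x q + kl q m <= kl x m.
Proof.
move=> x0 xq qm q0 m1.
rewrite (@kl_split x q m)//; try lra.
rewrite lerD2l; have := @kl_cross_antitone x q q m q0 qm m1 xq.
by apply: le_trans; rewrite /kl lexx.
Qed.

Lemma kl_mono_right x q m : 0 <= x -> x <= q -> q <= m -> 0 < m < 1 -> kl x q <= kl x m.
Proof.
move=> x0 xq qm /andP[m0 m1].
have [q0|qn0] := eqVneq q 0.
  have -> : x = q by apply/eqP; rewrite eq_le xq q0.
  rewrite kl_self; apply: kl_ge0; rewrite ?kl_finite ?m0//; lra.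
have q0 : 0 < q by rewrite lt_def qn0 (le_trans x0).
apply: le_trans (@kl_triangle x q m x0 xq qm q0 m1).
rewrite lerDl; apply: kl_ge0; rewrite ?kl_finite ?m0//; lra.
Qed.

Lemma kl_lt_anti x q m : 0 < x -> x < q -> q <= m -> m < 1 -> kl q m < kl x m.
Proof.
move=> x0 xq qm m1; have q0 : 0 < q by lra.
apply: lt_le_trans (@kl_triangle x q m (ltW x0) (ltW xq) qm q0 m1).
rewrite ltrDr; apply: lt_le_trans (@kl_ge_sqr x q _ _ _); rewrite ?kl_finite; try lra.
by rewrite divr_gt0// exprn_even_gt0//= subr_eq0 lt_eqF.
Qed.

Lemma kl0_near m e : 0 < m < 1 -> 0 < e ->
  exists2 q, 0 < q <= m & kl 0 m - e <= kl q m.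
Proof.
move=> /andP[m0 m1] e0.
(* With [q = t * t <= t], the losses are at most [2 * t], [q] and [- q * ln (1 - m)], together at
   most [t * c]. Taking [q] to be a square gives [q * ln q >= - (2 * t)] from a bound on [ln t]. *)
pose c := 3 - ln (1 - m).
have lm : ln (1 - m) <= 0 by apply: ln_le0; lra.
have c0 : 0 < c by rewrite /c; lra.
pose t := Num.min (e / c) m.
have t0 : 0 < t by rewrite lt_min m0 divr_gt0.
have tm : t <= m by rewrite ge_min lexx orbT.
have tc : t * c <= e by rewrite -ler_pdivlMr// ge_min lexx.
have q0 : 0 < t * t by rewrite mulr_gt0.
have qt : t * t <= t by rewrite ler_piMr; lra.
exists (t * t); first by rewrite q0/= (le_trans qt).
have q1 : t * t < 1 by lra.
set q := t * t in q0 qt q1 *.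
have -> : kl 0 m = - ln (1 - m).
  by rewrite /kl mul0r add0r subr0 mul1r div1r lnV// posrE subr_gt0.
rewrite /kl !ln_div ?posrE ?subr_gt0//.
have lt : 1 - t^-1 <= ln t.
  have := @ln_le_sub1 t^-1; rewrite invr_gt0 t0 => /(_ isT).
  by rewrite lnV ?posrE//; lra.
have lq : ln q = 2 * ln t by rewrite /q lnM ?posrE//; ring.
have a1 : - (2 * t) <= q * ln q.
  have : q * (1 - t^-1) <= q * ln t by rewrite ler_pM2l.
  rewrite /q mulrBr (_ : t * t * t^-1 = t); last by field; lra.
  rewrite -/q lq; nra.
have a2 : - q <= (1 - q) * ln (1 - q).
  have := @ln_le_sub1 (1 - q)^-1; rewrite invr_gt0 subr_gt0 q1 => /(_ isT).
  rewrite lnV ?posrE ?subr_gt0// => h.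
  have : (1 - q) * - ln (1 - q) <= (1 - q) * ((1 - q)^-1 - 1) by rewrite ler_pM2l// subr_gt0.
  rewrite [X in _ <= X]mulrBr divff; [lra|lra].
have a3 : ln m <= 0 by apply: ln_le0; lra.
have : t * 3 - t * ln (1 - m) <= e by move: tc; rewrite /c mulrBr.
have := ler_wpM2l _ qt; nra.
Qed.

(* A common threshold for the event [k <= n * kl x m]; attaining [k] exactly may force
   the degenerate threshold [0], so a slack of [1] keeps it positive. *)
Lemma kl_threshold m (n : nat) k : 0 < m < 1 -> (0 < n)%N -> 0 <= k ->
  exists2 q, 0 < q <= m & forall x, 0 <= x <= m -> k <= n%:R * kl x m ->
    x <= q /\ k - 1 <= n%:R * kl q m.
Proof.
move=> m01 n0 k0; have /andP[m0 m1] := m01.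
have n0' : 0 < n%:R :> R by rewrite ltr0n.
(* A slack of [n%:R^-1] in [kl] becomes a slack of 1 after multiplication by [n]. *)
have [dl /andP[dl0 dlm] hdl] := @kl0_near m n%:R^-1 m01 ltac:(by rewrite invr_gt0).
have anti (x q : R) : 0 < q -> q <= m -> 0 <= x <= m -> k <= n%:R * kl x m ->
    n%:R * kl q m <= k -> x <= q.
  move=> q0 qm /andP[x0 xm] hx hq; rewrite leNgt; apply/negP => qx.
  have := @kl_lt_anti q x m q0 qx xm m1.
  by rewrite -(ltr_pM2l n0'); lra.
(* If the level [k] is attained on [[dl, m]], the intermediate value theorem gives an exact
   threshold; otherwise [dl] serves, at the price of the slack. *)
have [kd|kd] := leP k (n%:R * kl dl m).
- have cont : {within `[dl, m], continuous (fun x : R => n%:R * kl x m)}.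
    apply: continuous_in_subspaceT => x; rewrite inE/= in_itv/= => /andP[x1 x2].
    have cx : x @[x --> x] --> x by exact: cvg_id.
    apply: cvgM; first exact: cvg_cst.
    apply: cvgD; apply: cvgM.
    + exact: cvg_id.
    + apply: (@continuous_comp _ _ _ (fun x : R => x / m) (@ln R)).
        by apply: cvgM; [exact: cvg_id|exact: cvg_cst].
      by apply: continuous_ln; rewrite divr_gt0//; lra.
    + by apply: cvgB; [exact: cvg_cst|exact: cvg_id].
    + apply: (@continuous_comp _ _ _ (fun x : R => (1 - x) / (1 - m)) (@ln R)).
        apply: cvgM; last exact: cvg_cst.
        by apply: cvgB; [exact: cvg_cst|exact: cvg_id].
      by apply: continuous_ln; rewrite divr_gt0//; lra.
  have [|q] := @IVT R _ dl m k dlm cont.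
    by rewrite kl_self mulr0 ge_min le_max k0 kd orbT.
  rewrite in_itv/= => /andP[q1 q2] hq.
  exists q; first by rewrite (lt_le_trans dl0)//.
  move=> x hx hk; split; last by rewrite hq; lra.
  by apply: anti => //; [lra|rewrite hq].
- exists dl; first by rewrite dl0.
  move=> x hx hk; split; first by apply: anti => //; exact: ltW.
  have xk : kl x m <= kl 0 m.
    have /andP[x0 xm] := hx; have [->//|xn0] := eqVneq x 0.
    have xp : 0 < x by rewrite lt_def xn0.
    apply: le_trans (@kl_triangle 0 x m (lexx _) x0 xm xp m1).
    by rewrite lerDr; apply: kl_ge0; rewrite ?kl_finite; lra.
  have : n%:R * (kl 0 m - n%:R^-1) <= n%:R * kl dl m by rewrite ler_pM2l.
  have : n%:R * kl x m <= n%:R * kl 0 m by rewrite ler_pM2l.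
  rewrite mulrBr divff ?gt_eqF//; lra.
Qed.

(* [kb] encodes the log-likelihood ratio between the Bernoulli laws of means [q] (the
   threshold of [kl_threshold]) and [u]; the first two clauses make
   [exp (kb.1 * j - kb.2 * S_j)] a supermartingale for any mean at least [u]. *)
Lemma chernoff_tilt m u d (n : nat) k : 0 < m -> m < u -> u < 1 ->
    d <= (m - u) ^+ 2 / 2 -> (0 < n)%N -> 0 <= k ->
  exists kb : R * R, [/\ 0 <= kb.2,
    expR kb.1 * (1 - u + u * expR (- kb.2)) <= 1 &
    forall x, 0 <= x <= m -> k <= n%:R * kl x m ->
      k - 1 + n%:R * d <= kb.1 * n%:R - kb.2 * (n%:R * x)].
Proof.
move=> m0 mu u1 hd n0 k0.
have [|q /andP[q0 qm] hq] := @kl_threshold m n k _ n0 k0; first by lra.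
have n0' : 0 < n%:R :> R by rewrite ltr0n.
pose ka := ln ((1 - q) / (1 - u)); pose l := ln (q / u).
have l0 : l <= 0 by rewrite ln_le0// ler_pdivrMr ?mul1r; lra.
have ka0 : 0 <= ka by rewrite ln_ge0// ler_pdivlMr ?mul1r; lra.
(* This tilt turns the Bernoulli law of mean [u] into that of mean [q], so its total mass is exactly
   1. *)
exists (ka, ka - l); split => /=; first by lra.
  rewrite opprB expRB /ka /l !lnK ?posrE ?divr_gt0 ?subr_gt0//; try lra.
  rewrite le_eqVlt; apply/orP; left; apply/eqP; field.
  by apply/and3P; split; lra.
move=> x hx hk; have [xq hqk] := hq x hx hk.
(* The distance from [m] to [u] supplies the surplus [n%:R * d]. *)
have tri : kl q m + kl m u <= kl q u by apply: kl_triangle => //; lra.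
have klmu : d <= kl m u.
  by apply: (le_trans hd); apply: kl_ge_sqr; rewrite ?kl_finite; lra.
have := @kl_cross_antitone x q q u q0 ltac:(lra) u1 xq.
rewrite -/l -/ka => h1.
have h2 : kl q m + d <= x * l + (1 - x) * ka.
  by apply: le_trans h1; rewrite -/(kl q u) (le_trans _ tri)// lerD2l.
have : n%:R * (kl q m + d) <= n%:R * (x * l + (1 - x) * ka) by rewrite ler_pM2l.
rewrite (_ : ka * n%:R - (ka - l) * (n%:R * x) = n%:R * (x * l + (1 - x) * ka)); last by ring.
rewrite mulrDr; lra.
Qed.

(** From [expR la <= (1 - la)^-1 <= 1 + la + 2 * la ^+ 2], where the second inequality uses
    [la <= 1/2]. *)
Lemma upper_tilt (la mu0 : R) : 0 <= la <= 1/2 -> 0 <= mu0 <= 1 ->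
  1 - mu0 + mu0 * expR la <= expR (la * mu0 + 2 * la ^+ 2).
Proof.
move=> /andP[l0 l1] /andP[m0 m1].
have h1 : expR la <= 1 + la + 2 * la ^+ 2.
  have := expR_ge1Dx (- la); rewrite expRN => h.
  have : expR la * (1 - la) <= 1.
    by rewrite mulrC -ler_pdivlMr ?expR_gt0// mul1r.
  have := expR_gt0 la; set E := expR la => E0 h2.
  rewrite -(@ler_pM2r _ (1 - la)); last lra.
  apply: (le_trans h2); nra.
apply: le_trans (expR_ge1Dx _).
have := sqr_ge0 la => s0.
have : mu0 * expR la <= mu0 * (1 + la + 2 * la ^+ 2) by apply: ler_wpM2l.
nra.
Qed.
End real_lemmas.

(** * Histories and the sampling rule *)

Section histories.
Context {R : realType} {K : nat}.
Implicit Types (h : history R K.+1) (a b : 'I_K.+1).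

Definition reward_sum h a : R := \sum_(p <- h | p.1 == a) p.2.

(** An invariant of the sampling rule; the second clause encodes the initial pass over the arms in
    order. *)
Definition reachable h : Prop :=
  all (fun p => 0 <= p.2 <= 1) h /\ forall a, (0 < npulls h a)%N = (a < size h)%N.

Lemma npulls_rcons h b (y : R) a : npulls (rcons h (b, y)) a = (npulls h a + (b == a))%N.
Proof. by rewrite /npulls -cats1 count_cat /= addn0. Qed.

Lemma reward_sum_rcons h b (y : R) a :
  reward_sum (rcons h (b, y)) a = reward_sum h a + (if b == a then y else 0).
Proof. by rewrite /reward_sum -cats1 big_cat /= big_cons big_nil /= addr0. Qed.

Lemma reward_sum_nil a : reward_sum [::] a = 0.
Proof. by rewrite /reward_sum big_nil. Qed.

Lemma npulls_le_size h a : (npulls h a <= size h)%N.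
Proof. exact: count_size. Qed.

Lemma reward_sum_bounds h a : all (fun p => 0 <= p.2 <= 1) h ->
  0 <= reward_sum h a <= (npulls h a)%:R.
Proof.
rewrite /reward_sum /npulls; elim: h => [|p h IH]/=; first by rewrite big_nil lexx.
move=> /andP[/andP[p0 p1] /IH/andP[s0 s1]]; rewrite big_cons.
case: ifP => _ /=; last by rewrite add0n s0.
by rewrite natrD addr_ge0//= lerD.
Qed.

Lemma reachable_rcons h b (y : R) : reachable h -> klms_policy h b != 0 ->
  0 <= y <= 1 -> reachable (rcons h (b, y)).
Proof.
move=> [h01 hn] pb y01; split; first by rewrite all_rcons /= y01.
move=> a; rewrite npulls_rcons size_rcons addn_gt0 hn lt0b.
move: pb; rewrite /klms_policy; case: ltnP => hK.
  case: (nat_of_ord b =P size h) => [bh _|_]; last by rewrite eqxx.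
  by rewrite ltnS [in RHS]leq_eqVlt orbC -bh eq_sym.
move=> _; have aK := ltn_ord a.
by rewrite (leq_trans aK hK) ltnS (leq_trans (ltnW aK) hK).
Qed.

Lemma klms_weight_ge0 n (p q : R) : 0 <= klms_weight n p q.
Proof. by rewrite /klms_weight; case: ifP => // _; exact: expR_ge0. Qed.

Lemma klms_policy_ge0 h a : 0 <= klms_policy h a.
Proof.
rewrite /klms_policy; case: ifP => _; first by case: ifP.
by rewrite divr_ge0 ?klms_weight_ge0// sumr_ge0// => b _; exact: klms_weight_ge0.
Qed.

Lemma klms_weight_self n (p : R) : klms_weight n p p = 1.
Proof.
rewrite /klms_weight /kl_infinite andbN andbN /=.
by rewrite kl_self mulr0 oppr0 expR0.
Qed.

Lemma klms_weight_le1 n (p q : R) : 0 <= p <= 1 -> 0 <= q <= 1 -> klms_weight n p q <= 1.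
Proof.
move=> p01 q01; rewrite /klms_weight; case: ifP => // /negbT fin.
by rewrite expR_le1 oppr_le0 mulr_ge0// kl_ge0.
Qed.

Section after_initialisation.
Variable h : history R K.+1.
Hypotheses (reach : reachable h) (hK : (K < size h)%N).

Lemma npulls_gt0 a : (0 < npulls h a)%N.
Proof. by case: reach => _ ->; rewrite (leq_trans (ltn_ord a)). Qed.

Lemma muhat_bounds a : 0 <= muhat h a <= 1.
Proof.
have n0 : 0 < (npulls h a)%:R :> R by rewrite ltr0n npulls_gt0.
have /andP[s0 s1] := reward_sum_bounds a reach.1.
by rewrite /muhat -/(reward_sum h a) divr_ge0//= ler_pdivrMr// mul1r.
Qed.

Lemma reward_sumE a : reward_sum h a = (npulls h a)%:R * muhat h a.
Proof.
rewrite /muhat -/(reward_sum h a) mulrC divfK// pnatr_eq0 -lt0n.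
exact: npulls_gt0.
Qed.

Lemma muhat_le_max a : muhat h a <= muhatmax h.
Proof. by rewrite /muhatmax; apply: le_bigmax. Qed.

Lemma muhatmax_attained : exists a, muhatmax h = muhat h a.
Proof.
rewrite /muhatmax; have [a _ ->] := @eq_bigmax _ _ _ 0 ord0 xpredT (muhat h) isT
  (fun a _ => proj1 (andP (muhat_bounds a))).
by exists a.
Qed.

Lemma muhatmax_bounds : 0 <= muhatmax h <= 1.
Proof. by have [a ->] := muhatmax_attained; exact: muhat_bounds. Qed.

Lemma klms_normaliser_ge1 :
  1 <= \sum_(b < K.+1) klms_weight (npulls h b) (muhat h b) (muhatmax h).
Proof.
have [a ha] := muhatmax_attained.
rewrite (bigD1 a)//= ha klms_weight_self lerDl sumr_ge0// => b _.
exact: klms_weight_ge0.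
Qed.

Lemma klms_policyE a : klms_policy h a =
  klms_weight (npulls h a) (muhat h a) (muhatmax h) /
       \sum_(b < K.+1) klms_weight (npulls h b) (muhat h b) (muhatmax h).
Proof. by rewrite /klms_policy ltnNge hK. Qed.

Lemma klms_policy_le_weight a :
  klms_policy h a <= klms_weight (npulls h a) (muhat h a) (muhatmax h).
Proof.
have W1 := klms_normaliser_ge1; have W0 := lt_le_trans ltr01 W1.
by rewrite klms_policyE ler_pdivrMr// ler_peMr// klms_weight_ge0.
Qed.

(** The common normaliser cancels and the weight of [a] is at most 1. Since
    [muhat h c <= muhatmax h < m], replacing the maximum by [m] only increases the divergence of
    [c]. *)
Lemma klms_policy_le_exp a c m : muhatmax h < m -> m < 1 ->
  klms_policy h a <=
  klms_policy h c * expR ((npulls h c)%:R * kl (muhat h c) m).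
Proof.
move=> hm m1; rewrite !klms_policyE mulrAC.
have W0 := lt_le_trans ltr01 klms_normaliser_ge1.
rewrite ler_pM2r ?invr_gt0//.
apply: (le_trans (klms_weight_le1 _ (muhat_bounds a) muhatmax_bounds)).
have /andP[M0 M1] := muhatmax_bounds.
have /andP[x0 x1] := muhat_bounds c.
have xM := muhat_le_max c.
rewrite /klms_weight.
have -> : kl_infinite (muhat h c) (muhatmax h) = false.
  apply/negbTE; rewrite /kl_infinite negb_or !negb_and !negbK.
  apply/andP; split; last by rewrite lt_eqF//; lra.
  have [M00|//] := eqVneq (muhatmax h) 0.
  by rewrite eq_le x0 andbT -M00 xM.
rewrite -expRD -[X in X <= _]expR0 ler_expR addrC subr_ge0.
by apply: ler_wpM2l => //; apply: kl_mono_right => //; lra.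
Qed.
End after_initialisation.

Lemma klms_policy_sum h : reachable h -> \sum_(a < K.+1) klms_policy h a = 1.
Proof.
move=> reach; have [hK|hK] := ltnP (size h) K.+1.
  under eq_bigr do rewrite /klms_policy hK.
  rewrite (bigD1 (Ordinal hK))//= eqxx big1 ?addr0// => a /negP aK.
  by case: eqP => // ah; case: aK; apply/eqP/val_inj.
under eq_bigr do rewrite klms_policyE//.
rewrite -mulr_suml divff// gt_eqF//.
exact: lt_le_trans ltr01 (klms_normaliser_ge1 reach hK).
Qed.

Lemma klms_policy_le1 h a : reachable h -> klms_policy h a <= 1.
Proof.
move=> reach; rewrite -(klms_policy_sum reach) (bigD1 a)//= lerDl sumr_ge0// => b _.
exact: klms_policy_ge0.
Qed.

(* By convexity in the last reward only Bernoulli rewards matter, which removes any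
   measurability concern about [klms_future_reward]. *)
Lemma future_reward_ge_potential (nu : 'I_K.+1 -> probability R R) (mu1 : R)
    (T : nat) (Phi : history R K.+1 -> R) :
  (forall a, nu a `[0%R, 1%R]%classic = 1%E) ->
  (forall h, 0 <= Phi h) ->
  (forall h b (y : R), 0 <= y <= 1 -> Phi (rcons h (b, y)) <=
     (1 - y) * Phi (rcons h (b, 0)) + y * Phi (rcons h (b, 1))) ->
  (forall h, reachable h -> (size h < T)%N ->
     \sum_(b < K.+1) klms_policy h b * (mu1 - arm_mean nu b +
       ((1 - arm_mean nu b) * Phi (rcons h (b, 0)) +
        arm_mean nu b * Phi (rcons h (b, 1)))) <= Phi h) ->
  forall r h, reachable h -> (size h + r)%N = T ->
    ((r%:R * mu1 - Phi h)%:E <= klms_future_reward nu r h)%E.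
Proof.
move=> nu01 Phi0 Phic Phid; elim=> [|r IH] h reach sT.
  by rewrite /= mul0r sub0r lee_fin oppr_le0.
(* Induction and convexity bound reward plus future from below by an affine function of the last
   reward; [w a] is its value at the mean of [a]. *)
pose w a := r%:R * mu1 - Phi (rcons h (a, 0)) +
  (1 + Phi (rcons h (a, 0)) - Phi (rcons h (a, 1))) * arm_mean nu a.
apply: (@le_trans _ _ (\sum_(a < K.+1) (klms_policy h a * w a)%:E)%E); last first.
  rewrite /=; apply: lee_sum => a _.
  (* Pulling an arm of probability zero may leave the reachable histories, where induction says
     nothing; its term vanishes. *)
  have [->|pa] := eqVneq (klms_policy h a) 0; first by rewrite mul0r mul0e.
  rewrite EFinM; apply: lee_wpmul2l; first by rewrite lee_fin klms_policy_ge0.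
  apply: (integral_ge_affine (nu01 a)) => y y01.
  have := IH _ (reachable_rcons reach pa y01); rewrite size_rcons addSn -addnS.
  move=> /(_ sT); have := Phic h a y y01; move: (klms_future_reward _ _ _) => V h1 h2.
  apply: (@le_trans _ _ (y%:E + (r%:R * mu1 - Phi (rcons h (a, y)))%:E)%E).
    rewrite -EFinD lee_fin; lra.
  exact: leeD.
rewrite sumEFin lee_fin.
have szT : (size h < T)%N by rewrite -sT addnS ltnS leq_addr.
have := Phid h reach szT.
have ps := klms_policy_sum reach.
rewrite (_ : \sum_(a < K.+1) klms_policy h a * w a = r.+1%:R * mu1 * \sum_(a < K.+1) klms_policy h a
  - \sum_(b < K.+1) klms_policy h b * (mu1 - arm_mean nu b +
       ((1 - arm_mean nu b) * Phi (rcons h (b, 0)) +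
        arm_mean nu b * Phi (rcons h (b, 1))))).
  by rewrite ps mulr1 lerD2l lerN2.
rewrite mulr_sumr -sumrB; apply: eq_bigr => a _; rewrite /w -natr1; ring.
Qed.

End histories.

(** * Potentials *)

Section potentials.
Context {R : realType} {K : nat}.
Variables (mu : 'I_K.+1 -> R) (T : nat).
Hypothesis mu01 : forall a, 0 <= mu a <= 1.
Implicit Types (h : history R K.+1) (a b c : 'I_K.+1).
Implicit Types (Psi : history R K.+1 -> R) (e : history R K.+1 -> 'I_K.+1 -> R).

Definition bernoulli_step Psi h b : R :=
  (1 - mu b) * Psi (rcons h (b, 0)) + mu b * Psi (rcons h (b, 1)).

(* [e h b] is what [Psi] can afford to lose, on average, when [b] is pulled after [h]. *)
Definition pays Psi e : Prop :=
  [/\ forall h, 0 <= Psi h,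
      forall h b (y : R), 0 <= y <= 1 -> Psi (rcons h (b, y)) <=
        (1 - y) * Psi (rcons h (b, 0)) + y * Psi (rcons h (b, 1)) &
      forall h b, (size h < T)%N -> bernoulli_step Psi h b + e h b <= Psi h].

Lemma eq_pays Psi e Psi' e' : Psi =1 Psi' -> e =2 e' -> pays Psi e -> pays Psi' e'.
Proof.
move=> /funext <- ee; suff -> : e = e' by [].
by apply/funext => h; apply/funext => b.
Qed.

Lemma pays0 : pays (fun=> 0) (fun _ _ => 0).
Proof.
by split => // [h b y _|h b _]; rewrite /bernoulli_step !mulr0 !addr0.
Qed.

Lemma paysD Psi e Psi' e' : pays Psi e -> pays Psi' e' ->
  pays (fun h => Psi h + Psi' h) (fun h b => e h b + e' h b).
Proof.
move=> [p1 p2 p3] [q1 q2 q3]; split=> [h|h b y y01|h b hT].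
- by rewrite addr_ge0.
- by have := p2 h b y y01; have := q2 h b y y01; lra.
- by have := p3 h b hT; have := q3 h b hT; rewrite /bernoulli_step; lra.
Qed.

Lemma paysZ (k : R) Psi e : 0 <= k -> pays Psi e ->
  pays (fun h => k * Psi h) (fun h b => k * e h b).
Proof.
move=> k0 [p1 p2 p3]; split=> [h|h b y y01|h b hT].
- by rewrite mulr_ge0.
- by have := ler_wpM2l k0 (p2 h b y y01); lra.
- by have := ler_wpM2l k0 (p3 h b hT); rewrite /bernoulli_step; lra.
Qed.

Lemma pays_sum (I : Type) (r : seq I) (P : pred I)
    (Psi : I -> history R K.+1 -> R) (e : I -> history R K.+1 -> 'I_K.+1 -> R) :
  (forall i, P i -> pays (Psi i) (e i)) ->
  pays (fun h => \sum_(i <- r | P i) Psi i h) (fun h b => \sum_(i <- r | P i) e i h b).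
Proof.
move=> Hp; elim: r => [|i r IH].
  by apply: eq_pays pays0 => [h|h b]; rewrite big_nil.
have [Pi|Pi] := boolP (P i).
  by apply: eq_pays (paysD (Hp i Pi) IH) => [h|h b]; rewrite big_cons Pi.
by apply: eq_pays IH => [h|h b]; rewrite big_cons (negbTE Pi).
Qed.

Lemma pays_pulls a (U : nat) : pays (fun h => (U - npulls h a)%:R)
  (fun h b => if (b == a) && (npulls h a < U)%N then 1 else 0).
Proof.
split=> [h|h b y y01|h b hT]; rewrite /bernoulli_step ?ler0n// !npulls_rcons.
  by rewrite -mulrDl subrK mul1r.
rewrite -mulrDl subrK mul1r; case: (b == a) => /=; last by rewrite addn0 addr0.
case: ifPn => hU; last by rewrite addr0 ler_nat leq_sub2l// leq_addr.
by rewrite natr1 ler_nat addn1 subnS prednK// subn_gt0.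
Qed.

Lemma pays_clock : (0 < T)%N -> pays (fun h => (T - size h)%:R / T%:R) (fun _ _ => T%:R^-1).
Proof.
move=> T0; split=> [h|h b y y01|h b hT]; rewrite /bernoulli_step ?size_rcons.
- by rewrite divr_ge0.
- by rewrite -mulrDl subrK mul1r.
- rewrite -mulrDl subrK mul1r -[X in _ + X]mul1r -mulrDl ler_pM2r ?invr_gt0 ?ltr0n//.
  by rewrite natr1 ler_nat subnS prednK// subn_gt0.
Qed.

(** The Cramér-Chernoff statistic of arm [c]: a pull of [c] with reward [y] multiplies it by
    [expR (al + ga * y)], and other pulls leave it unchanged. *)
Definition exp_stat c (al ga de : R) h : R :=
  expR (al * (npulls h c)%:R + ga * reward_sum h c + de).

Lemma exp_stat_rcons c al ga de h b (y : R) :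
  exp_stat c al ga de (rcons h (b, y)) =
  exp_stat c al ga de h * (if b == c then expR al * expR (ga * y) else 1).
Proof.
rewrite /exp_stat npulls_rcons reward_sum_rcons; case: eqP => _.
  by rewrite -!expRD addn1 -natr1; congr expR; ring.
by rewrite addn0 addr0 mulr1.
Qed.

Lemma exp_stat_ge0 c al ga de h : 0 <= exp_stat c al ga de h.
Proof. exact: expR_ge0. Qed.

Lemma exp_stat_convex c al ga de h b (y : R) : 0 <= y <= 1 ->
  exp_stat c al ga de (rcons h (b, y)) <=
  (1 - y) * exp_stat c al ga de (rcons h (b, 0)) + y * exp_stat c al ga de (rcons h (b, 1)).
Proof.
move=> y01; rewrite !exp_stat_rcons; set X := exp_stat _ _ _ _ _.
have X0 : 0 <= X by exact: exp_stat_ge0.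
case: ifP => _; last by rewrite -mulrDl subrK mul1r.
rewrite !mulr0 expR0 !mulr1.
have := expR_chord ga y01 => hc.
have := ler_wpM2l (mulr_ge0 X0 (expR_ge0 al)) hc; lra.
Qed.

Lemma exp_stat_step c al ga de h b :
  bernoulli_step (exp_stat c al ga de) h b = exp_stat c al ga de h *
    (if b == c then expR al * (1 - mu c + mu c * expR ga) else 1).
Proof.
rewrite /bernoulli_step !exp_stat_rcons; case: eqP => [->|_]; last by ring.
by rewrite mulr0 expR0 !mulr1; ring.
Qed.

(** Each pull of [c] shrinks the statistic on average by a factor [1 - s], so its values at these
    pulls sum like a geometric series of total [s^-1]. *)
Lemma pays_geometric c al ga de (s : R) : 0 < s ->
  expR al * (1 - mu c + mu c * expR ga) <= 1 - s ->
  pays (fun h => s^-1 * exp_stat c al ga de h)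
    (fun h b => if b == c then exp_stat c al ga de h else 0).
Proof.
move=> s0 hs; split=> [h|h b y y01|h b hT].
- by rewrite mulr_ge0 ?exp_stat_ge0// invr_ge0 ltW.
- have := @exp_stat_convex c al ga de h b y y01.
  have s1 : 0 <= s^-1 by rewrite invr_ge0 ltW.
  by move=> /(ler_wpM2l s1); lra.
- have -> : bernoulli_step (fun h => s^-1 * exp_stat c al ga de h) h b =
      s^-1 * bernoulli_step (exp_stat c al ga de) h b by rewrite /bernoulli_step; ring.
  rewrite exp_stat_step; have := exp_stat_ge0 c al ga de h.
  set X := exp_stat _ _ _ _ _ => X0.
  case: ifP => _; last by rewrite mulr1 addr0.
  set r := expR al * _ in hs *.
  have h1 : X * r <= X * (1 - s) by exact: ler_wpM2l.
  have s1 : 0 <= s^-1 by rewrite invr_ge0 ltW.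
  have := ler_wpM2l s1 h1; rewrite mulrBr mulr1 mulrBr.
  rewrite (_ : s^-1 * (X * s) = X); last by field; lra.
  lra.
Qed.

(** Killing the statistic at the pull of [c] numbered [n.+1] frees its whole value to be spent
    there. *)
Definition gated_stat c n (al ga de : R) h : R :=
  if (npulls h c <= n)%N then exp_stat c al ga de h else 0.

Lemma gated_stat_ge0 c n al ga de h : 0 <= gated_stat c n al ga de h.
Proof. by rewrite /gated_stat; case: ifP => // _; exact: exp_stat_ge0. Qed.

Lemma gated_stat_convex c n al ga de h b (y : R) : 0 <= y <= 1 ->
  gated_stat c n al ga de (rcons h (b, y)) <=
  (1 - y) * gated_stat c n al ga de (rcons h (b, 0)) +
  y * gated_stat c n al ga de (rcons h (b, 1)).
Proof.
move=> y01; rewrite /gated_stat !npulls_rcons; case: ifP => _.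
  exact: exp_stat_convex.
by rewrite !mulr0 addr0.
Qed.

Lemma gated_stat_step c n al ga de h b :
  expR al * (1 - mu c + mu c * expR ga) <= 1 ->
  bernoulli_step (gated_stat c n al ga de) h b +
    (if (b == c) && (npulls h c == n) then exp_stat c al ga de h else 0) <=
  gated_stat c n al ga de h.
Proof.
move=> hs; rewrite /bernoulli_step /gated_stat !npulls_rcons.
have X0 := exp_stat_ge0 c al ga de h.
have := exp_stat_step c al ga de h b; rewrite /bernoulli_step.
have [bc|bc] /= := eqVneq b c; last first.
  by rewrite addn0 mulr1 addr0; case: ifP => _; lra.
move=> e1; rewrite addn1; case: (ltngtP (npulls h c) n) => hn.
- by rewrite addr0 e1 ler_piMr.
- by rewrite !mulr0 !addr0.
- by rewrite !mulr0 !add0r.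
Qed.

Lemma pays_gated c n al ga de :
  expR al * (1 - mu c + mu c * expR ga) <= 1 ->
  pays (gated_stat c n al ga de)
    (fun h b => if (b == c) && (npulls h c == n) then exp_stat c al ga de h else 0).
Proof.
move=> hs; split=> [h|h b y y01|h b hT]; first exact: gated_stat_ge0.
  exact: gated_stat_convex.
exact: gated_stat_step.
Qed.

(** Arm [c] may stay at [n] pulls for many rounds, each of which must be paid; the number of
    remaining rounds bounds how often. *)
Lemma pays_countdown c n al ga de :
  expR al * (1 - mu c + mu c * expR ga) <= 1 ->
  pays (fun h => (T - size h)%:R * gated_stat c n al ga de h)
    (fun h _ => if npulls h c == n then exp_stat c al ga de h else 0).
Proof.
move=> hs; split=> [h|h b y y01|h b hT].
- by rewrite mulr_ge0// gated_stat_ge0.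
- rewrite !size_rcons; have := gated_stat_convex c n al ga de h b y01.
  move=> /(ler_wpM2l (ler0n R (T - (size h).+1))); lra.
- rewrite /bernoulli_step !size_rcons.
  have -> : (T - size h)%:R = (T - (size h).+1)%:R + 1 :> R.
    by rewrite natr1; congr (_%:R); lia.
  have := gated_stat_step n de h b hs; rewrite /bernoulli_step => h1.
  have h2 : 0 <= (if (b == c) && (npulls h c == n) then exp_stat c al ga de h else 0).
    by case: ifP => // _; exact: exp_stat_ge0.
  have h3 : (if npulls h c == n then exp_stat c al ga de h else 0) <=
      gated_stat c n al ga de h.
    by rewrite /gated_stat; case: eqP => [->|_]; [rewrite leqnn|exact: gated_stat_ge0].
  have : (1 - mu b) * gated_stat c n al ga de (rcons h (b, 0)) +
       mu b * gated_stat c n al ga de (rcons h (b, 1)) <= gated_stat c n al ga de h by lra.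
  move=> /(ler_wpM2l (ler0n R (T - (size h).+1))); lra.
Qed.
End potentials.

(** * Paying for the pulls of one suboptimal arm *)

Section arm_regret.
Context {R : realType} {K : nat}.
Variables (mu : 'I_K.+1 -> R) (T : nat).
Hypothesis mu01 : forall a, 0 <= mu a <= 1.
Implicit Types (h : history R K.+1) (a b c : 'I_K.+1).

Definition expected_cost (e : history R K.+1 -> 'I_K.+1 -> R) h : R :=
  \sum_(b < K.+1) klms_policy h b * e h b.

Lemma expected_cost_ge0 e h : (forall h b, 0 <= e h b) -> 0 <= expected_cost e h.
Proof. by move=> e0; apply: sumr_ge0 => b _; rewrite mulr_ge0// klms_policy_ge0. Qed.

Lemma expected_costD e e' h :
  expected_cost (fun h b => e h b + e' h b) h = expected_cost e h + expected_cost e' h.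
Proof. by rewrite /expected_cost -big_split/=; apply: eq_bigr => b _; rewrite mulrDr. Qed.

Lemma expected_cost_ge_pull e h c (v : R) : (forall h b, 0 <= e h b) -> v <= e h c ->
  klms_policy h c * v <= expected_cost e h.
Proof.
move=> e0 hv; rewrite /expected_cost (bigD1 c)//=.
apply: (le_trans (ler_wpM2l (klms_policy_ge0 h c) hv)).
by rewrite lerDl sumr_ge0// => b _; rewrite mulr_ge0// klms_policy_ge0.
Qed.

Lemma expected_cost_ge_round e h (v : R) : reachable h -> (forall b, v <= e h b) ->
  v <= expected_cost e h.
Proof.
move=> reach hv; rewrite -[v]mul1r -(klms_policy_sum reach) mulr_suml.
by apply: ler_sum => b _; rewrite ler_wpM2l// klms_policy_ge0.
Qed.

(** With [Y] the count of the best arm times [kl] of its empirical mean to [m], a level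
    [k <= Y < k + 1] is charged [expR k.+1] at pulls of the best arm, and [Y >= L] is charged 1 at
    every round. The initial values of the statistics offset these prices and leave a geometric
    series in the count. *)
Lemma underestimation_potential (m u d : R) (L : nat) :
  0 < m -> m < u -> u < 1 -> u <= mu ord0 -> d <= (m - u) ^+ 2 / 2 -> 0 < d <= 1 ->
  T%:R <= expR (L%:R : R) ->
  exists Psi e, [/\ pays mu T Psi e, (forall h b, 0 <= e h b),
    Psi [::] <= (expR 2 * L%:R + expR 1) * (2 / d) &
    forall h a, reachable h -> (K < size h)%N -> (size h < T)%N -> muhatmax h < m ->
      klms_policy h a <= expected_cost e h].
Proof.
move=> m0 mu' u1 uc hd d01 hTL.
have /choice[kb hkb] : forall ik : nat * nat, exists kb : R * R, [/\ 0 <= kb.2,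
    expR kb.1 * (1 - u + u * expR (- kb.2)) <= 1 &
    forall x, 0 <= x <= m -> ik.2%:R <= ik.1.+1%:R * kl x m ->
      ik.2%:R - 1 + ik.1.+1%:R * d <= kb.1 * ik.1.+1%:R - kb.2 * (ik.1.+1%:R * x)].
  by move=> [i k]; apply: chernoff_tilt => //; rewrite ler0n.
pose c : 'I_K.+1 := ord0.
pose de (i k : nat) : R := 1 - k%:R - i.+1%:R * d.
pose z (i k : nat) := exp_stat c (kb (i, k)).1 (- (kb (i, k)).2) (de i k) : history R K.+1 -> R.
pose g (i k : nat) := gated_stat c i.+1 (kb (i, k)).1 (- (kb (i, k)).2) (de i k)
  : history R K.+1 -> R.
(* The tilt is nonincreasing in the mean because its exponent is nonpositive, so the bound at [u]
   passes to [mu c >= u]. *)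
have super i k : expR (kb (i, k)).1 * (1 - mu c + mu c * expR (- (kb (i, k)).2)) <= 1.
  have [be0 h1 _] := hkb (i, k); apply: le_trans h1.
  apply: ler_wpM2l; first exact: expR_ge0.
  have : expR (- (kb (i, k)).2) <= 1 by rewrite expR_le1 oppr_le0.
  rewrite /c; nra.
have z_ge1 i k h : reachable h -> (K < size h)%N -> npulls h c = i.+1 ->
    muhat h c <= m -> k%:R <= i.+1%:R * kl (muhat h c) m -> 1 <= z i k h.
  move=> reach hK hn xm hk; rewrite -[X in X <= _]expR0 /z /exp_stat ler_expR.
  have /andP[x0 _] := muhat_bounds reach hK c.
  have [_ _ /(_ (muhat h c))] := hkb (i, k); rewrite x0 xm /= => /(_ isT hk).
  by rewrite reward_sumE// hn /de; lra.
pose P1 h := \sum_(i < T) \sum_(k < L) expR (k.+1%:R : R) * g i k h.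
pose e1 h b := \sum_(i < T) \sum_(k < L) expR (k.+1%:R : R) *
  (if (b == c) && (npulls h c == i.+1) then z i k h else 0).
pose P2 h := \sum_(i < T) (T - size h)%:R * g i L h.
pose e2 h (b : 'I_K.+1) := \sum_(i < T) (if npulls h c == i.+1 then z i L h else 0).
have z0 i k h : 0 <= z i k h by exact: exp_stat_ge0.
have e10 h b : 0 <= e1 h b.
  apply: sumr_ge0 => i _; apply: sumr_ge0 => k _; rewrite mulr_ge0 ?expR_ge0//.
  by case: ifP.
have e20 h b : 0 <= e2 h b by apply: sumr_ge0 => i _; case: ifP.
have p1 : pays mu T P1 e1.
  apply: pays_sum => i _; apply: pays_sum => k _; apply: paysZ; first exact: expR_ge0.
  exact: pays_gated.
have p2 : pays mu T P2 e2 by apply: pays_sum => i _; exact: pays_countdown.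
exists (fun h => P1 h + P2 h), (fun h b => e1 h b + e2 h b); split.
- exact: paysD.
- by move=> h b; rewrite addr_ge0.
(* The price [expR k.+1] times the initial value is at most [expR 2 * expR (- (i%:R * d))]; at the
   top level [T%:R <= expR L%:R] cancels the horizon. *)
- have g_nil i k : g i k [::] = expR (1 - k%:R - d) * expR (- (i%:R * d)).
    rewrite /g /gated_stat /exp_stat reward_sum_nil /= !mulr0 !add0r -expRD.
    by congr expR; rewrite /de -natr1; ring.
  have hS := sum_expRN_le T d01; have := d01 => /andP[d0 _].
  rewrite big_mkord in hS.
  have ed : expR (- d) <= 1 by rewrite expR_le1 oppr_le0 ltW.
  rewrite mulrDl; apply: lerD.
    apply: (@le_trans _ _ (\sum_(i < T) (expR 2 * L%:R) * expR (- (i%:R * d)))).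
      apply: ler_sum => i _.
      rewrite (_ : expR 2 * L%:R * _ = \sum_(k < L) expR 2 * expR (- (i%:R * d))); last first.
        by rewrite sumr_const card_ord -mulr_natr; ring.
      apply: ler_sum => k _; rewrite g_nil -!expRD ler_expR -natr1; lra.
    by rewrite -mulr_sumr ler_wpM2l// mulr_ge0// expR_ge0.
  apply: (@le_trans _ _ (\sum_(i < T) expR 1 * expR (- (i%:R * d)))).
    apply: ler_sum => i _; rewrite g_nil subn0 mulrA ler_wpM2r ?expR_ge0//.
    apply: (le_trans (ler_wpM2r (expR_ge0 _) hTL)).
    rewrite -expRD ler_expR; lra.
  by rewrite -mulr_sumr ler_wpM2l// expR_ge0.
- move=> h a reach hK hT hm; rewrite expected_costD.
  have xm : muhat h c <= m by apply: le_trans (ltW hm); exact: muhat_le_max.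
  have n0 := npulls_gt0 reach hK c.
  have iT : ((npulls h c).-1 < T)%N.
    by rewrite (leq_ltn_trans _ hT)// (leq_trans (leq_pred _))// npulls_le_size.
  have [i hn] : exists i : 'I_T, npulls h c = i.+1.
    by exists (Ordinal iT); rewrite /= prednK.
  pose Y := (npulls h c)%:R * kl (muhat h c) m.
  have [x0 x1] := andP (muhat_bounds reach hK c).
  have Y0 : 0 <= Y by rewrite /Y mulr_ge0// kl_ge0 ?kl_finite; lra.
  have [YL|YL] := ltP Y L%:R.
  + have /andP[tY1 tY2] := truncn_itv Y0.
    have kL : (Num.truncn Y < L)%N by rewrite -(ltr_nat R) (le_lt_trans tY1).
    have [k [kY Yk]] : exists k : 'I_L, (k%:R : R) <= Y /\ Y < (k.+1%:R : R).
      by exists (Ordinal kL).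
    apply: (@le_trans _ _ (expected_cost e1 h)); last first.
      by rewrite lerDl expected_cost_ge0.
    have le1 : muhatmax h < m by [].
    apply: (le_trans (klms_policy_le_exp reach hK a c le1 _)); first lra.
    apply: expected_cost_ge_pull => //.
    rewrite /e1 (bigD1 i)//= (bigD1 k)//= -hn !eqxx /=.
    rewrite -[X in X <= _]addr0 -[X in X + 0 <= _]addr0 -/Y; apply: lerD; first apply: lerD.
    * have z1 : 1 <= z i k h by apply: z_ge1 => //; rewrite -hn.
      apply: (@le_trans _ _ (expR (k.+1%:R : R))); first by rewrite ler_expR ltW.
      by rewrite ler_peMr// expR_ge0.
    * apply: sumr_ge0 => k' _; rewrite mulr_ge0 ?expR_ge0//.
    * apply: sumr_ge0 => i' _; apply: sumr_ge0 => k' _; rewrite mulr_ge0 ?expR_ge0//.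
      by case: ifP.
  + apply: (@le_trans _ _ (expected_cost e2 h)); last first.
      by rewrite lerDr expected_cost_ge0.
    apply: (le_trans (klms_policy_le1 a reach)).
    apply: expected_cost_ge_round => // b.
    rewrite /e2 (bigD1 i)//= -hn eqxx -[X in X <= _]addr0; apply: lerD.
      by apply: z_ge1 => //; rewrite -hn.
    by apply: sumr_ge0 => i' _; case: ifP.
Qed.

(** The statistic is at least 1 whenever the empirical mean exceeds [mu a + ep], yet decays
    geometrically along the pulls of [a]. *)
Lemma overestimation_potential a (ep : R) : 0 < ep <= 1 ->
  exists Psi e, [/\ pays mu T Psi e, (forall h b, 0 <= e h b),
    Psi [::] <= 16 / ep ^+ 2 &
    forall h, reachable h -> (K < size h)%N -> mu a + ep <= muhat h a ->
      klms_policy h a <= expected_cost e h].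
Proof.
move=> /andP[ep0 ep1].
(* This [la] minimises the exponent [2 * la ^+ 2 - la * ep], with value [- (ep ^+ 2 / 8)]. *)
pose la := ep / 4; pose al := - (la * (mu a + ep)).
have ee0 : 0 < ep ^+ 2 by rewrite exprn_gt0.
have step : expR al * (1 - mu a + mu a * expR la) <= 1 - ep ^+ 2 / 16.
  apply: (@le_trans _ _ (expR (- (ep ^+ 2 / 8)))).
    apply: (@le_trans _ _ (expR al * expR (la * mu a + 2 * la ^+ 2))).
      apply: ler_wpM2l; first exact: expR_ge0.
      by apply: upper_tilt => //; rewrite /la; lra.
    by rewrite -expRD ler_expR /al /la; lra.
  have := @expRN_le_half R (ep ^+ 2 / 8); rewrite (_ : _ <= _ <= _); last by nra.
  by move=> /(_ isT); lra.
have s0 : 0 < ep ^+ 2 / 16 by rewrite divr_gt0.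
have e0 h b : 0 <= (if b == a then exp_stat a al la 0 h else 0) :> R.
  by case: ifP => // _; exact: exp_stat_ge0.
exists (fun h => (ep ^+ 2 / 16)^-1 * exp_stat a al la 0 h),
  (fun h b => if b == a then exp_stat a al la 0 h else 0); split => //.
- exact: pays_geometric.
- by rewrite /exp_stat reward_sum_nil /= !mulr0 !addr0 expR0 mulr1 invf_div.
- move=> h reach hK hx.
  rewrite -[X in X <= _]mulr1; apply: expected_cost_ge_pull => //.
  rewrite eqxx /exp_stat -[X in X <= _]expR0 ler_expR reward_sumE// addr0 /al.
  have l0 : 0 <= la * (npulls h a)%:R by rewrite mulr_ge0// /la; lra.
  by have := ler_wpM2l l0 hx; lra.
Qed.
Hypothesis T2 : (2 <= T)%N.

Lemma klms_policy_le_inv h a (U : nat) (gap : R) : reachable h -> (K < size h)%N ->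
  (U <= npulls h a)%N -> 0 <= gap -> muhat h a + gap <= muhatmax h ->
  ln T%:R <= U%:R * (gap ^+ 2 / 2) -> klms_policy h a <= T%:R^-1.
Proof.
move=> reach hK hU gap0 hgap hln.
have T0 : 0 < T%:R :> R by rewrite ltr0n (leq_trans _ T2).
apply: (le_trans (klms_policy_le_weight reach hK a)).
rewrite /klms_weight; case: ifP => [_|/negbT fin]; first by rewrite invr_ge0 ltW.
rewrite -[X in _ <= X^-1](lnK (_ : T%:R \is Num.pos)) ?posrE// -expRN ler_expR lerN2.
apply: (le_trans hln); apply: ler_pM.
- by rewrite ler0n.
- by rewrite divr_ge0// sqr_ge0.
- by rewrite ler_nat.
apply: le_trans (kl_ge_sqr (muhat_bounds reach hK a) (muhatmax_bounds reach hK) fin).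
rewrite ler_pM2r// -[leRHS]sqrrN opprB ler_sqr ?nnegrE//; lra.
Qed.

Lemma arm_potential a : mu a < mu ord0 ->
  exists Psi e, [/\ pays mu T Psi e,
    Psi [::] <= 20000 * (ln T%:R / (mu ord0 - mu a) ^+ 2) &
    forall h, reachable h -> (size h < T)%N -> klms_policy h a <= expected_cost e h].
Proof.
move=> hmu; pose D := mu ord0 - mu a; have D0 : 0 < D by rewrite subr_gt0.
have /andP[a0 a1] := mu01 a; have /andP[c0 c1] := mu01 ord0.
have D1 : D <= 1 by rewrite /D; lra.
(* Thresholds [mu a + ep] and [mu ord0 - ep] stay [D / 2] apart. With [u = mu ord0 - ep / 2], [d] is
   exactly [(m - u) ^+ 2 / 2]. *)
pose ep := D / 4; pose d := ep ^+ 2 / 8.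
pose l : R := ln T%:R.
have T0 : (0 < T)%N by exact: leq_trans T2.
have l_half : 1 / 2 <= l.
  have : ln (2%:R : R) <= l by rewrite /l ler_ln ?posrE ?ltr0n// ler_nat.
  apply: le_trans; have := @ln_le_sub1 R 2^-1; rewrite invr_gt0 => /(_ ltac:(lra)).
  by rewrite lnV ?posrE//; lra.
have l0 : 0 <= l by lra.
(* [L] ensures [T%:R <= expR L%:R], and [U] ensures [l <= U%:R * ((D / 2) ^+ 2 / 2)]. *)
pose L := (Num.truncn l).+1; pose U := (Num.truncn (8 * l / D ^+ 2)).+1.
have DD0 : 0 < D ^+ 2 by rewrite exprn_gt0.
have DD1 : D ^+ 2 <= 1 by rewrite expr_le1// ltW.
have u0 : 0 <= 8 * l / D ^+ 2 by rewrite divr_ge0 ?(ltW DD0)//; lra.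
have /andP[L1 L2] := truncn_itv l0; have /andP[U1 U2] := truncn_itv u0.
have TL : T%:R <= expR (L%:R : R).
  by rewrite -[X in X <= _]lnK ?posrE ?ltr0n// ler_expR ltW.
have ep2 : ep ^+ 2 = D ^+ 2 / 16 by rewrite /ep; field.
have [P1 [e1 [p1 e10 i1 h1]]] : exists Psi e,
    [/\ pays mu T Psi e, (forall h b, 0 <= e h b),
    Psi [::] <= (expR 2 * L%:R + expR 1) * (2 / d) &
    forall h a, reachable h -> (K < size h)%N -> (size h < T)%N -> muhatmax h < mu ord0 - ep ->
      klms_policy h a <= expected_cost e h].
  apply: (@underestimation_potential (mu ord0 - ep) (mu ord0 - ep / 2)) => //.
  - by rewrite /ep /D; lra.
  - by rewrite /ep; lra.
  - by rewrite /ep; lra.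
  - by rewrite /ep; lra.
  - by rewrite /d; lra.
  - by rewrite /d ep2; lra.
have [P2 [e2 [p2 e20 i2 h2]]] := @overestimation_potential a ep ltac:(rewrite /ep; lra).
have p3 := pays_pulls mu T a U; have p4 := pays_clock mu T0.
exists (fun h => (P1 h + P2 h) + ((U - npulls h a)%:R + (T - size h)%:R / T%:R)).
exists (fun h b => (e1 h b + e2 h b) +
  ((if (b == a) && (npulls h a < U)%N then 1 else 0) + T%:R^-1)); split.
- exact: paysD (paysD p1 p2) (paysD p3 p4).
- rewrite /= !subn0 divff ?pnatr_eq0 -?lt0n//.
  have E : 2 / d = 256 / D ^+ 2 by rewrite /d ep2; field; lra.
  have E2 : 16 / ep ^+ 2 = 256 / D ^+ 2 by rewrite ep2; field; lra.
  rewrite E in i1; rewrite E2 in i2.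
  have e1_4 : expR (1 : R) <= 4.
    have := @expRN_le_half R 1; rewrite expRN.
    have := expR_gt0 (1 : R); set x := expR 1 => x0 hx.
    have : x^-1 * x = 1 by rewrite mulVf// gt_eqF.
    have := expR_ge1Dx (- (1 / 2) : R); have -> : x = (expR (1/2) * expR (1/2)).
      by rewrite -expRD /x; congr expR; lra.
    rewrite expRN; set y := expR (1/2); have y0 : 0 < y by exact: expR_gt0.
    have : y^-1 * y = 1 by rewrite mulVf// gt_eqF.
    move=> yy hy _; have : y <= 2 by nra.
    nra.
  have e2_16 : expR (2 : R) <= 16.
    have -> : expR (2 : R) = expR 1 * expR 1 by rewrite -expRD; congr expR; lra.
    by have := expR_ge0 (1 : R); nra.
  (* Since [1 <= Q <= 2 * l * Q], all terms are multiples of [l * Q], with coefficients adding up to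
     less than 20000. *)
  pose Q := (D ^+ 2)^-1; have Q1 : 1 <= Q by rewrite invf_ge1.
  have LL : (L%:R : R) <= l + 1 by rewrite /L -natr1 lerD2r.
  have UU : (U%:R : R) <= 8 * l * Q + 1 by rewrite /U -natr1 lerD2r.
  have m1 : (expR 2 * L%:R + expR 1) * (256 * Q) <= (16 * (l + 1) + 4) * (256 * Q).
    apply: ler_wpM2r; first lra.
    apply: lerD => //; apply: ler_pM => //; exact: expR_ge0.
  have lQ : 1 * Q <= 2 * l * Q by rewrite ler_pM2r; lra.
  rewrite -/l -/D -/Q in i1 i2 *.
  lra.
- move=> h reach hT; rewrite !expected_costD.
  set E1 := expected_cost e1 h; set E2 := expected_cost e2 h.
  set E3 := expected_cost _ h; set E4 := expected_cost _ h.
  have E10 : 0 <= E1 by exact: expected_cost_ge0.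
  have E20 : 0 <= E2 by exact: expected_cost_ge0.
  have E30 : 0 <= E3 by apply: expected_cost_ge0 => h' b; case: ifP.
  have E40 : 0 <= E4 by apply: expected_cost_ge0 => h' b; rewrite invr_ge0.
  have few : (npulls h a < U)%N -> klms_policy h a <= E3.
    move=> hU; rewrite -[X in X <= _]mulr1; apply: expected_cost_ge_pull.
      by move=> h' b; case: ifP.
    by rewrite eqxx hU.
  (* During the initial pass arm [a] can only be pulled with count 0, which the counter pays. *)
  have [hK|hK] := ltnP (size h) K.+1.
    have [ah|ah] := eqVneq (nat_of_ord a) (size h).
      have : npulls h a = 0%N by have := reach.2 a; rewrite ah ltnn; case: (npulls h a).
      by move=> n0; have := few; rewrite n0 => /(_ isT); lra.
    by rewrite /klms_policy hK (negbTE ah); lra.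
  have [/few|hU] := ltnP (npulls h a) U; first lra.
  have [hm|hm] := ltP (muhatmax h) (mu ord0 - ep).
    by have := h1 h a reach hK hT hm; rewrite -/E1; lra.
  have [ho|ho] := leP (mu a + ep) (muhat h a).
    by have := h2 h reach hK ho; rewrite -/E2; lra.
  have : klms_policy h a <= T%:R^-1.
    apply: (@klms_policy_le_inv h a U (D / 2)) => //.
    - lra.
    - by move: ho hm; rewrite /ep /D; lra.
    - have : 8 * l / D ^+ 2 * ((D / 2) ^+ 2 / 2) <= U%:R * ((D / 2) ^+ 2 / 2).
        by apply: ler_wpM2r; [rewrite divr_ge0// sqr_ge0|exact: ltW].
      rewrite (_ : 8 * l / D ^+ 2 * _ = l)//; field; lra.
  have : T%:R^-1 <= E4 by apply: expected_cost_ge_round.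
  lra.
Qed.
End arm_regret.

(** * Summing the potentials of the arms, weighted by their gaps *)

Theorem theorem2 (R : realType) :
  exists C : R, 0 < C /\
  forall (K : nat) (nu : 'I_K.+1 -> probability R R) (T : nat),
    (1 <= K)%N ->
    (forall a, nu a `[0%R, 1%R]%classic = 1%E) ->
    (forall a b : 'I_K.+1, (a <= b)%N -> arm_mean nu b <= arm_mean nu a) ->
    (klms_regret nu T <=
     (C * \sum_(a < K.+1 | 0 < arm_mean nu ord0 - arm_mean nu a)
            ln T%:R / (arm_mean nu ord0 - arm_mean nu a))%:E)%E.
Proof.
exists 20000; split; first lra.
move=> K nu T _ nu01 mono; set mu := arm_mean nu.
have mu01 a : 0 <= mu a <= 1 by exact: mean_unit_interval.
have regret_le (x : R) : ((T%:R * mu ord0 - x)%:E <= klms_future_reward nu T [::])%E ->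
    (klms_regret nu T <= x%:E)%E.
  rewrite /klms_regret -/mu; case: (klms_future_reward _ _ _) => [v| |] //=.
  - by rewrite !lee_fin; lra.
  - by move=> _; rewrite leNye.
have [T2|T2] := leqP 2 T; last first.
  (* For [T <= 1] the logarithm is 0, by convention at [T = 0]; the only possible round pulls the
     best arm. *)
  have -> : ln (T%:R : R) = 0 by case: T T2 {regret_le} => [|[|//]] _; rewrite ?ln1// ln0.
  rewrite big1 ?mulr0; last by move=> a _; rewrite mul0r.
  apply: regret_le; apply: (@future_reward_ge_potential _ _ _ _ T (fun=> 0)) => //=.
  - by move=> h b y _; rewrite !mulr0 addr0.
  - move=> h reach hT; have /nilP -> : nilp h by rewrite /nilp -leqn0 -ltnS (leq_trans hT).
    rewrite big1// => b _; rewrite !mulr0 !addr0 /klms_policy /=.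
    have [b0|_] := eqVneq; last by rewrite mul0r.
    by rewrite (_ : b = ord0) ?subrr ?mulr0//; exact: val_inj.
have /choice[Pe hPe] : forall a : 'I_K.+1,
    exists Pe : (history R K.+1 -> R) * (history R K.+1 -> 'I_K.+1 -> R),
    0 < mu ord0 - mu a -> [/\ pays mu T Pe.1 Pe.2,
    Pe.1 [::] <= 20000 * (ln T%:R / (mu ord0 - mu a) ^+ 2) &
    forall h, reachable h -> (size h < T)%N -> klms_policy h a <= expected_cost Pe.2 h].
  move=> a; have [ha|ha] := ltP (mu a) (mu ord0); last first.
    by exists (fun=> 0, fun _ _ => 0); rewrite subr_gt0 ltNge ha.
  by have [Psi [e ?]] := arm_potential mu01 T2 ha; exists (Psi, e).
pose Phi h := \sum_(a < K.+1 | 0 < mu ord0 - mu a) (mu ord0 - mu a) * (Pe a).1 h.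
pose e h b := \sum_(a < K.+1 | 0 < mu ord0 - mu a) (mu ord0 - mu a) * (Pe a).2 h b.
have [Phi0 Phic Phid] : pays mu T Phi e.
  apply: pays_sum => a Da; apply: paysZ; first exact: ltW.
  by have [] := hPe a Da.
apply: (@le_trans _ _ (Phi [::])%:E); last first.
  rewrite lee_fin /Phi mulr_sumr; apply: ler_sum => a Da.
  have [_ hP _] := hPe a Da.
  apply: (le_trans (ler_wpM2l (ltW Da) hP)).
  by rewrite le_eqVlt; apply/orP; left; apply/eqP; field; rewrite gt_eqF.
apply: regret_le; apply: (@future_reward_ge_potential _ _ _ _ T Phi) => // h reach hT.
rewrite -/mu.
have paid : \sum_(b < K.+1) klms_policy h b * (mu ord0 - mu b) <= expected_cost e h.
  rewrite /expected_cost /e; under [leRHS]eq_bigr do rewrite mulr_sumr.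
  rewrite exchange_big/= (bigID (fun b => 0 < mu ord0 - mu b))/= [X in _ + X]big1 ?addr0.
    apply: ler_sum => a Da; have [_ _ hc] := hPe a Da.
    have := ler_wpM2l (ltW Da) (hc h reach hT); rewrite mulrC.
    rewrite /expected_cost mulr_sumr => hle; apply: (le_trans hle).
    by apply: ler_sum => b _; rewrite mulrCA.
  (* Arm [ord0] has the largest mean, so a nonpositive gap is zero. *)
  move=> b; rewrite -leNgt => Db.
  have := mono ord0 b (leq0n _); rewrite -/mu => mb.
  by rewrite (_ : mu ord0 - mu b = 0) ?mulr0//; lra.
apply: (@le_trans _ _ (expected_cost e h +
    \sum_(b < K.+1) klms_policy h b * bernoulli_step mu Phi h b)).
  rewrite -(lerD2r (- \sum_(b < K.+1) klms_policy h b * bernoulli_step mu Phi h b)) addrK -sumrB.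
  by apply: le_trans paid; apply: ler_sum => b _; rewrite /bernoulli_step; lra.
rewrite /expected_cost -big_split/= -[leRHS]mul1r -(klms_policy_sum reach) mulr_suml.
apply: ler_sum => b _; rewrite -mulrDr ler_wpM2l ?klms_policy_ge0// addrC.
exact: Phid.
Qed.
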